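(* Let $p>2$ be a prime and let $r\ge 1$ be an integer. Let $x,c$ be indeterminates over $\mathbb{Q}_p$, and let $c_1,\dots,c_r$ (in a splitting field over $\mathbb{Q}_p(x)$) satisfy $x(c-1)^r+c^{r-1}=x\prod_{i=1}^r(c-c_i)$. Then $$\sum_{0\le k<p}\binom{rk}{k}x^k\equiv -x^p\sum_{i=1}^r\frac{c_i-1}{r-1+c_i}\bigl(r-(r-1)c_i^p-r(1-c_i)^p\bigr)\pmod{p^2}.$$
   Context: Interpretation of the congruence: both sides are symmetric in $c_1,\dots,c_r$ and hence lie in $\mathbb{Q}_p(x)$; for $A,B\in\mathbb{Q}_p(x)$, $A\equiv B\pmod{p^n}$ means $A-B\in p^nR$, where $R$ is the valuation ring of $\mathbb{Q}_p(x)$ with respect to the $p$-adic (Gauss) valuation, i.e. the valuation extending $v_p$ with $v(\sum_j a_jx^j)=\min_j v_p(a_j)$ on polynomials. *)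

(* Defs.v *)
From HB Require Import structures.
From mathcomp Require Import all_boot all_order all_algebra all_field.
From mathcomp Require Import boolp constructive_ereal.

Set Implicit Arguments.
Unset Strict Implicit.
Unset Printing Implicit Defensive.

Import Order.TTheory GRing.Theory Num.Theory.
Local Open Scope ring_scope.

Definition Zpow_red (p n : nat) (a : 'Z_(p ^ n.+2)) : 'Z_(p ^ n.+1) :=
  (a : nat)%:R.

(* Z_p as the inverse limit of the rings Z/p^(n+1), n >= 0; starting at
   exponent 1 avoids 'Z_1, which is not the trivial ring.  The primality proof
   is a parameter of the type because the integral domain structure needs it. *)
Record padic_int (p : nat) (p_pr : prime p) := PadicInt {
  padic_seq :> forall n, 'Z_(p ^ n.+1);
  padic_coherent : forall n, Zpow_red (padic_seq n.+1) = padic_seq n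
}.

HB.instance Definition _ (p : nat) (p_pr : prime p) :=
  gen_eqMixin (padic_int p_pr).
HB.instance Definition _ (p : nat) (p_pr : prime p) :=
  gen_choiceMixin (padic_int p_pr).

Section PadicIntRing.
Variables (p : nat) (p_pr : prime p).
Local Notation Zp := (padic_int p_pr).

Lemma pexpS_gt1 n : (1 < p ^ n.+1)%N.
Proof. by rewrite (leq_trans (prime_gt1 p_pr)) // -{1}(expn1 p) leq_exp2l ?prime_gt1. Qed.

Lemma val_Zpow n (a : 'Z_(p ^ n.+1)) : (a < p ^ n.+1)%N.
Proof. by have := ltn_ord a; rewrite [X in (_ < X)%N]Zp_cast // pexpS_gt1. Qed.

Lemma val_ZpowE n m : ((m%:R : 'Z_(p ^ n.+1)) : nat) = (m %% p ^ n.+1)%N.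
Proof. exact: val_Zp_nat (pexpS_gt1 n) m. Qed.

Lemma Zpow_red_nat n m : Zpow_red (m%:R : 'Z_(p ^ n.+2)) = m%:R.
Proof.
apply: val_inj; rewrite /Zpow_red /= !val_ZpowE modn_dvdm //.
by rewrite (expnS p n.+1) dvdn_mull.
Qed.

Lemma Zpow_redD n : {morph @Zpow_red p n : a b / a + b}.
Proof.
move=> a b; rewrite -[a in LHS]natr_Zp -[b in LHS]natr_Zp -natrD.
by rewrite Zpow_red_nat natrD.
Qed.

Lemma Zpow_redM n : {morph @Zpow_red p n : a b / a * b}.
Proof.
move=> a b; rewrite -[a in LHS]natr_Zp -[b in LHS]natr_Zp -natrM.
by rewrite Zpow_red_nat natrM.
Qed.

Lemma Zpow_red0 n : @Zpow_red p n 0 = 0.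
Proof. exact: (Zpow_red_nat n 0). Qed.

Lemma Zpow_red1 n : @Zpow_red p n 1 = 1.
Proof. exact: (Zpow_red_nat n 1). Qed.

Lemma Zpow_redN n : {morph @Zpow_red p n : a / - a}.
Proof.
by move=> a; apply/eqP; rewrite -addr_eq0 -Zpow_redD addNr Zpow_red0.
Qed.

Lemma padic_ext (x y : Zp) : (forall n, x n = y n) -> x = y.
Proof.
case: x y => [x hx] [y hy] /= xy.
have {}xy : x = y by exact: functional_extensionality_dep.
by subst y; congr PadicInt; exact: Prop_irrelevance.
Qed.

Definition padic0 : Zp := PadicInt p_pr (padic_seq := fun=> 0) (@Zpow_red0).
Definition padic1 : Zp := PadicInt p_pr (padic_seq := fun=> 1) (@Zpow_red1).

Fact padic_opp_coherent (x : Zp) n : Zpow_red (- x n.+1) = - x n.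
Proof. by rewrite Zpow_redN padic_coherent. Qed.
Definition padic_opp (x : Zp) : Zp :=
  PadicInt p_pr (padic_opp_coherent x).

Fact padic_add_coherent (x y : Zp) n :
  Zpow_red (x n.+1 + y n.+1) = x n + y n.
Proof. by rewrite Zpow_redD !padic_coherent. Qed.
Definition padic_add (x y : Zp) : Zp :=
  PadicInt p_pr (padic_add_coherent x y).

Fact padic_mul_coherent (x y : Zp) n :
  Zpow_red (x n.+1 * y n.+1) = x n * y n.
Proof. by rewrite Zpow_redM !padic_coherent. Qed.
Definition padic_mul (x y : Zp) : Zp :=
  PadicInt p_pr (padic_mul_coherent x y).

Fact padic_addA : associative padic_add.
Proof. by move=> x y z; apply: padic_ext => n; exact: addrA. Qed.
Fact padic_addC : commutative padic_add.
Proof. by move=> x y; apply: padic_ext => n; exact: addrC. Qed.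
Fact padic_add0 : left_id padic0 padic_add.
Proof. by move=> x; apply: padic_ext => n; exact: add0r. Qed.
Fact padic_addN : left_inverse padic0 padic_opp padic_add.
Proof. by move=> x; apply: padic_ext => n; exact: addNr. Qed.

HB.instance Definition _ := GRing.isZmodule.Build Zp
  padic_addA padic_addC padic_add0 padic_addN.

Fact padic_mulA : associative padic_mul.
Proof. by move=> x y z; apply: padic_ext => n; exact: mulrA. Qed.
Fact padic_mulC : commutative padic_mul.
Proof. by move=> x y; apply: padic_ext => n; exact: mulrC. Qed.
Fact padic_mul1 : left_id padic1 padic_mul.
Proof. by move=> x; apply: padic_ext => n; exact: mul1r. Qed.
Fact padic_mulDl : left_distributive padic_mul +%R.
Proof. by move=> x y z; apply: padic_ext => n; exact: mulrDl. Qed.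
Fact padic_1neq0 : padic1 != 0.
Proof.
apply/eqP => /(congr1 (fun x : Zp => x 0%N)) /= /eqP.
by rewrite (oner_eq0 'Z_(p ^ 1)).
Qed.

HB.instance Definition _ := GRing.Zmodule_isComNzRing.Build Zp
  padic_mulA padic_mulC padic_mul1 padic_mulDl padic_1neq0.

Definition padic_unit : {pred Zp} := fun x => `[< exists y, y * x = 1 >].

Definition padic_inv (x : Zp) : Zp :=
  if pselect (exists y, y * x = 1) is left h then projT1 (cid h) else x.

Fact padic_mulV : {in padic_unit, left_inverse 1 padic_inv *%R}.
Proof.
move=> x /asboolP xU; rewrite /padic_inv; case: pselect => // h.
by case: (cid h).
Qed.
Fact padic_unitP x y : y * x = 1 -> padic_unit x.
Proof. by move=> yx; apply/asboolP; exists y. Qed.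
Fact padic_inv_out : {in [predC padic_unit], padic_inv =1 id}.
Proof.
move=> x /asboolPn xU; rewrite /padic_inv; case: pselect => // h.
Qed.

HB.instance Definition _ := GRing.ComNzRing_hasMulInverse.Build Zp
  padic_mulV padic_unitP padic_inv_out.

Lemma padic_modn (x : Zp) m n :
  (x m : nat) = (x (n + m)%N %% p ^ m.+1)%N.
Proof.
elim: n => [|n IHn]; first by rewrite modn_small // val_Zpow.
rewrite IHn addSn -(padic_coherent x (n + m)) /Zpow_red val_ZpowE modn_dvdm //.
by rewrite dvdn_exp2l // ltnS leq_addl.
Qed.

Fact padic_integral : GRing.integral_domain_axiom Zp.
Proof.
have nz (x : Zp) : x != 0 -> exists n, x n != 0.
  move=> x0; apply: contrapT => hx; move/eqP: x0; apply.
  apply: padic_ext => n; apply/eqP; apply: contrapT => xn.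
  by apply: hx; exists n; apply/negP.
move=> x y xy0; have [//|/nz[m xm]] := eqVneq x 0.
have [//|/nz[n yn]] := eqVneq y 0.
have : (x * y) (n + m).+1 = 0 by rewrite xy0.
rewrite /= -[x _]natr_Zp -[y _]natr_Zp -natrM => /(congr1 val) /=.
rewrite val_ZpowE => /eqP; rewrite -/(dvdn _ _) => pxy.
have ndiv (z : Zp) k l : (k <= l)%N -> z k != 0 -> ~~ (p ^ k.+1 %| z l)%N.
  move=> /subnK <-; apply: contra; rewrite /dvdn -padic_modn => /eqP zk.
  exact/eqP/val_inj.
have hm := ndiv x m (n + m).+1 (leqW (leq_addl _ _)) xm.
have hn := ndiv y n (n + m).+1 (leqW (leq_addr _ _)) yn.
have pos (k l : nat) : ~~ (p ^ k.+1 %| l)%N -> (0 < l)%N.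
  by case: l => //; rewrite dvdn0.
move: hm hn pxy; set a : nat := x _; set b : nat := y _ => hm hn.
have a0 := pos _ _ hm; have b0 := pos _ _ hn.
rewrite pfactor_dvdn // ?muln_gt0 ?a0 // lognM //.
move: hm hn; rewrite !pfactor_dvdn // -!ltnNge !ltnS => hm hn.
by move=> h; have := leq_trans h (leq_add hm hn); rewrite addnC -ltnS ltnNge leqW ?leqnSn.
Qed.

HB.instance Definition _ := GRing.ComUnitRing_isIntegral.Build Zp
  padic_integral.

End PadicIntRing.

Definition padic (p : nat) (p_pr : prime p) : fieldType :=
  {fraction (padic_int p_pr)}.

(* The component of index n lives modulo p^(n+1), so the least n with x n != 0
   is the valuation of x. *)
Definition padic_int_val (p : nat) (p_pr : prime p) (x : padic_int p_pr) :
    \bar int :=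
  if pselect (exists n, x n != 0) is left h then (ex_minn h)%:Z%:E else +oo%E.

(* v(a/b) = v(a) - v(b), here and for gauss_val.  repr picks one fraction; its
   denominator is nonzero, hence of finite valuation, and the value does not
   depend on the choice since v is multiplicative. *)
Definition padic_val (p : nat) (p_pr : prime p) (x : padic p_pr) : \bar int :=
  (padic_int_val \n_(repr x) - padic_int_val \d_(repr x))%E.

Definition padic_ratfun (p : nat) (p_pr : prime p) : fieldType :=
  {fraction {poly (padic p_pr)}}.

Definition ratfunX (p : nat) (p_pr : prime p) : padic_ratfun p_pr :=
  FracField.tofrac ('X : {poly (padic p_pr)}).

Definition gauss_poly_val (p : nat) (p_pr : prime p) (a : {poly (padic p_pr)}) :
    \bar int :=
  \big[Order.min/+oo%E]_(j < size a) padic_val a`_j.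

Definition gauss_val (p : nat) (p_pr : prime p) (A : padic_ratfun p_pr) :
    \bar int :=
  (gauss_poly_val \n_(repr A) - gauss_poly_val \d_(repr A))%E.

Definition gauss_ring (p : nat) (p_pr : prime p) :
    {pred padic_ratfun p_pr} :=
  fun A => (0 <= gauss_val A)%E.

Definition gauss_congr (p : nat) (p_pr : prime p) (n : nat)
    (A B : padic_ratfun p_pr) : Prop :=
  exists2 D, D \in @gauss_ring p p_pr & A - B = p%:R ^+ n * D.

(* Main.v *)
Require Import Defs.
From mathcomp Require Import all_boot all_order all_algebra all_field.
From mathcomp Require Import ring zify boolp constructive_ereal.

Set Implicit Arguments.
Unset Strict Implicit.
Unset Printing Implicit Defensive.

(** Write y for the image of x in L and w_i = (c_i - 1) / (r - 1 + c_i).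

    The change of variable t = - 1 / c turns the equation satisfied by the c_i
    into f(t) = 0, where f = t - y (1 + t)^r is the polynomial whose inversion
    produces the series sum_k C(rk,k) y^k: the relation for the c_i is the
    factorization f = - y prod_i (1 + c_i t).  As y is transcendental, no c_i
    is 0 or 1 - r, hence f has simple roots and partial fractions give
    1 / f = sum_i w_i c_i / (1 + c_i t)  ([sum_cofactor], [kernel_inverse]).
    So the coefficient a_n of t^n in 1 / f is
    - sum_i w_i (- c_i)^(n+1).

    The truncated sum S = sum_(k < p) C(rk,k) y^k is the coefficient of
    t^(p-1) in the geometric sum
      sum_(k < p) t^(p-1-k) (y (1 + t)^r)^k = (t^p - y^p (1 + t)^(rp)) / f,
    so that, exactly ([sum_bin_kernel]),
      S = - y^p sum_(j < p) C(rp,j) a_(p-1-j).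
    Modulo p^2 one has C(rp,j) = r C(p,j) for 0 < j < p ([bin_mul_prime]);
    after this replacement the binomial theorem sums the right-hand side to
    the expression in the c_i of the theorem.

    The error term is p^2 times a Z-linear combination of the y^p a_(p-1-j).
    Since f has constant term - y and coefficients in Z[y], each
    y^(n+1) a_n lies in Z[y] ([inv_coef_int]); hence the error is p^2 d(x)
    with d a polynomial with integer coefficients ([sum_bin_congr]).  This
    shows at once that the right-hand side is in Q_p(x), and that it is
    congruent to S, because integer polynomials have nonnegative Gauss
    valuation ([gauss_ring_int]). *)

Import Order.TTheory GRing.Theory Num.Theory.
Local Open Scope ring_scope.

Local Notation "a %:F" := (FracField.tofrac a).

(** * Binomial coefficients and polynomials *)

(** Induction on [r]: in the Vandermonde expansion of C((r+1)p, j), every term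
    other than the two extreme ones is a product of two multiples of [p]. *)
Lemma bin_mul_prime p r j : prime p -> (0 < j < p)%N ->
  exists e, 'C(r * p, j) = (r * 'C(p, j) + p ^ 2 * e)%N.
Proof.
move=> p_pr; elim: r j => [|r IHr] j /andP[j_gt0 j_ltp].
  by exists 0%N; rewrite !mul0n muln0 bin0n; case: j j_gt0 {j_ltp}.
have [e He] := IHr j (introT andP (conj j_gt0 j_ltp)).
have mid (i : 'I_j) : (0 < i)%N -> (p ^ 2 %| 'C(p, i) * 'C(r * p, j - i))%N.
  move=> i_gt0; have i_ltp := ltn_trans (ltn_ord i) j_ltp.
  have ij : (0 < j - i < p)%N by have := ltn_ord i; lia.
  rewrite -mulnn dvdn_mul ?prime_dvd_bin ?i_gt0 //.
  have [e' ->] := IHr _ ij.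
  apply: dvdn_add; first by rewrite dvdn_mull // prime_dvd_bin.
  by rewrite dvdn_mulr // dvdn_exp.
have /dvdnP[q Hq] :
    (p ^ 2 %| \sum_(i < j | (0 < i)%N) 'C(p, i) * 'C(r * p, j - i))%N.
  by apply: dvdn_sum => i; apply: mid.
exists (e + q)%N.
rewrite mulSn -binomial.Vandermonde big_ord_recr /= subnn bin0 muln1.
case: j j_gt0 j_ltp He mid Hq {IHr} => // j _ j_ltp He mid Hq.
rewrite (bigD1 ord0) //= bin0 subn0 mul1n He.
rewrite (eq_bigl (fun i : 'I_j.+1 => 0 < i)%N) ?Hq; last by move=> [[|i] Hi].
nia.
Qed.

Lemma poly_eq_nat (L : idomainType) (P Q : {poly L}) :
  (forall n : nat, n%:R = 0 :> L -> n = 0%N) ->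
  (forall n : nat, P.[n%:R] = Q.[n%:R]) -> P = Q.
Proof.
move=> char0 PQ; apply/eqP; rewrite -subr_eq0; apply: contraT => nz.
have := max_poly_roots (rs := [seq n%:R | n <- iota 0 (size (P - Q))]) nz.
rewrite size_map size_iota ltnn; apply.
  by apply/allP => z /mapP[n _ ->]; rewrite rootE !hornerE PQ subrr.
rewrite map_inj_uniq ?iota_uniq // => m n.
wlog le_mn : m n / (m <= n)%N.
  by move=> H; case: (leqP m n) => [/H//|/ltnW/H + /esym] => /[apply].
by move/eqP; rewrite eq_sym -subr_eq0 -natrB // => /eqP/char0; lia.
Qed.

Lemma coef_1DX_exp (R : nzRingType) n k :
  ((1 + 'X : {poly R}) ^+ n)`_k = 'C(n, k)%:R.
Proof.
rewrite addrC exprD1n coef_sum; have [le_kn | lt_nk] := leqP k n.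
  rewrite (bigD1 (inord k)) //= coefMn coefXn inordK // eqxx.
  rewrite big1 ?addr0 // => i ik.
  rewrite coefMn coefXn; case: eqP => [E|_]; last by rewrite mul0rn.
  by case/eqP: ik; apply: val_inj; rewrite /= -E inordK.
rewrite bin_small // big1 // => i _; rewrite coefMn coefXn gtn_eqF ?mul0rn //.
exact: leq_trans (ltn_ord i) lt_nk.
Qed.

(** * Partial fractions of 1 / (t - y (1 + t)^r) *)

Section PartialFractions.
Variables (L : fieldType) (r : nat) (y : L) (c : 'I_r -> L).
Hypothesis r_gt0 : (0 < r)%N.
Hypothesis char0 : forall n : nat, n%:R = 0 :> L -> n = 0%N.
Hypothesis hc : y *: ('X - 1) ^+ r + 'X^(r.-1)
          = y *: \prod_(i < r) ('X - (c i)%:P).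

Definition kernel_poly : {poly L} := 'X - y *: (1 + 'X) ^+ r.

(** Up to the factor - (- t)^r this is the relation [hc] at - 1 / t.  The reversal
    is performed on values, at the infinitely many natural numbers. *)
Lemma kernel_poly_factor :
  kernel_poly = - y *: \prod_(i < r) (1 + c i *: 'X).
Proof.
apply: (poly_eq_nat char0) => n; rewrite /kernel_poly !hornerE horner_prod.
move: (n%:R) => s; have [-> | s0] := eqVneq s 0.
  rewrite addr0 expr1n mulr1 sub0r big1 ?mulr1 // => i _.
  by rewrite !hornerE ?mulr0 ?addr0.
have := congr1 (fun q => (- s) ^+ r * q.[- s^-1]) hc.
rewrite !hornerE horner_prod mulrDr.
rewrite [_ * (y * _)]mulrCA -exprMn mulrBr mulrNN mulfV // mulr1 opprK.
rewrite -{2}(prednK r_gt0) exprS -mulrA -exprMn mulrNN mulfV // expr1n mulr1.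
rewrite /= [_ ^+ _ * y]mulrC -mulrA.
have -> : (- s) ^+ r = \prod_(i < r) (- s) by rewrite prodr_const card_ord.
rewrite -big_split /=.
rewrite (eq_bigr (fun i => (1 + c i *: 'X).[s])); last first.
  by move=> i _; rewrite !hornerE mulrBr mulrNN mulfV // mulNr opprK mulrC.
by move=> H; rewrite mulNr -H opprB addrC.
Qed.

Hypothesis c_neq0 : forall i, c i != 0.
Hypothesis c_neq1r : forall i, r%:R - 1 + c i != 0.

(** By [cofactor_weight], this is the inverse of the derivative of
    [kernel_poly] at its root - 1 / c_i. *)
Definition weight i := (c i - 1) / (r%:R - 1 + c i).
Definition cofactor_poly i := - y *: \prod_(j < r | j != i) (1 + c j *: 'X).

Lemma kernel_cofactor i : kernel_poly = (1 + c i *: 'X) * cofactor_poly i.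
Proof. by rewrite kernel_poly_factor (bigD1 i) //= -scalerAr. Qed.

Lemma cofactor_root i j : j != i -> (cofactor_poly i).[- (c j)^-1] = 0.
Proof.
move=> ji; rewrite /cofactor_poly hornerZ horner_prod (bigD1 j) //=.
by rewrite !hornerE mulrN mulfV // subrr /= mulr0 mul0r.
Qed.

(** At t = - 1 / c_i the derivative of [kernel_poly] is
    c_i * (cofactor_poly i)(t); it is also 1 - r y (1 + t)^(r-1).  Multiplying
    by c_i - 1 = c_i (1 + t) and using y (1 + t)^r = t turns the latter into
    c_i + r - 1. *)
Lemma cofactor_weight i : weight i * c i * (cofactor_poly i).[- (c i)^-1] = 1.
Proof.
set t := - _; have ct : c i * t = -1 by rewrite mulrN mulfV.
have lin0 : (1 + c i *: 'X).[t] = 0 by rewrite !hornerE ct subrr.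
have Hf : y * (1 + t) ^+ r = t.
  have := congr1 (horner^~ t) (kernel_cofactor i).
  rewrite hornerM lin0 mul0r /kernel_poly !hornerE => /eqP.
  by rewrite subr_eq0 eq_sym => /eqP.
have Hd : c i * (cofactor_poly i).[t] = 1 - y * (1 + t) ^+ r.-1 * r%:R.
  have := congr1 (fun q => q^`().[t]) (kernel_cofactor i).
  rewrite derivM hornerD !hornerM lin0 mul0r addr0.
  have -> : (1 + c i *: 'X)^`().[t] = c i by rewrite !derivE !hornerE.
  move=> <-; rewrite /kernel_poly !derivE !hornerE.
  by rewrite deriv_exp !derivE add0r mul1r hornerMn !hornerE mulr_natr mulrnAr.
apply: (mulfI (c_neq1r i)); rewrite mulr1 -[in X in X = _]mulrA Hd /weight.
rewrite mulrA [_ * (_ / _)]mulrC divfK //.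
have -> : c i - 1 = c i * (1 + t) by rewrite mulrDr ct mulr1.
have -> : c i * (1 + t) * (1 - y * (1 + t) ^+ r.-1 * r%:R)
  = c i * (1 + t) - c i * (y * (1 + t) ^+ r) * r%:R.
  by rewrite -(prednK r_gt0) exprS /=; ring.
by rewrite Hf ct mulrDr ct; ring.
Qed.

(** Lagrange interpolation: both sides have degree less than [r] and agree at the
    [r] numbers - 1 / c_i, which are distinct because [cofactor_weight] makes
    the i-th cofactor nonzero at - 1 / c_i, while it vanishes at the others. *)
Lemma sum_cofactor : \sum_i (weight i * c i) *: cofactor_poly i = 1.
Proof.
pose D := \sum_i (weight i * c i) *: cofactor_poly i - 1.
suff /eqP : D = 0 by rewrite subr_eq0 => /eqP.
apply/eqP; apply: contraT => nz.
set rs := [seq - (c i)^-1 | i : 'I_r].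
suff [size_le root_rs uniq_rs] : [/\ (size D <= r)%N, all (root D) rs & uniq rs].
  have := max_poly_roots nz root_rs uniq_rs.
  by rewrite size_map size_enum_ord ltnNge size_le.
split.
- rewrite (leq_trans (size_polyD _ _)) // size_polyN size_poly1 geq_max r_gt0.
  rewrite andbT; apply/(leq_trans (size_sum _ _ _))/bigmax_leqP => i _.
  rewrite (leq_trans (size_scale_leq _ _)) // (leq_trans (size_scale_leq _ _)) //.
  rewrite (leq_trans (size_prod_leq _ _)) // leq_subLR.
  rewrite (@leq_trans (\sum_(j < r | j != i) 2)%N.+1) //.
    rewrite ltnS; apply: leq_sum => j _.
    rewrite (leq_trans (size_polyD _ _)) // size_poly1 geq_max /=.
    by rewrite (leq_trans (size_scale_leq _ _)) // size_polyX.
  rewrite sum_nat_const; have := cardC1 i; rewrite card_ord => -> /=.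
  by have := r_gt0; lia.
- apply/allP => _ /mapP[i _ ->]; rewrite rootE !hornerE horner_sum.
  rewrite (bigD1 i) //= big1 ?addr0 => [|j ji].
    by rewrite hornerZ cofactor_weight subrr.
  by rewrite hornerZ cofactor_root ?mulr0 // eq_sym.
- rewrite map_inj_in_uniq ?enum_uniq // => i j _ _ eq_ij.
  apply/eqP; apply: contraT => ij; have := cofactor_weight i.
  rewrite eq_ij cofactor_root ?mulr0 1?eq_sym // => /eqP.
  by rewrite eq_sym oner_eq0.
Qed.

(** The coefficient of t^n in the power series expansion of
    sum_i (weight i) c_i / (1 + c_i t), the inverse of [kernel_poly]. *)
Definition inv_coef n := \sum_i weight i * c i * (- c i) ^+ n.

(** Truncating each geometric series 1 / (1 + c_i t) leaves a multiple of t^n in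
    the identity [sum_cofactor]. *)
Lemma kernel_inverse n : exists E,
  kernel_poly * \poly_(k < n) inv_coef k = 1 + 'X^n * E.
Proof.
exists (- \sum_i (weight i * c i * (- c i) ^+ n) *: cofactor_poly i).
have -> : \poly_(k < n) inv_coef k =
   \sum_i (weight i * c i) *: \sum_(k < n) (- c i *: 'X) ^+ k.
  rewrite poly_def; under eq_bigr do rewrite scaler_suml.
  rewrite exchange_big /=; apply: eq_bigr => i _; rewrite scaler_sumr.
  by apply: eq_bigr => k _; rewrite exprZn scalerA.
rewrite mulr_sumr mulrN mulr_sumr -sum_cofactor -sumrB; apply: eq_bigr => i _.
rewrite (kernel_cofactor i) -scalerAr.
have := subrX1 (- c i *: 'X) n; rewrite exprZn => H.
have -> : 1 + c i *: 'X = - (- c i *: 'X - 1) :> {poly L}.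
  by rewrite scaleNr opprB opprK.
rewrite !mulNr [_ * cofactor_poly i * _]mulrAC -H.
rewrite mulrBl mul1r scalerN scalerBr opprB; congr (_ - _).
by move: (cofactor_poly i) => F; rewrite -scalerAl scalerA -scalerAr.
Qed.

(** The geometric sum [Q] below has the left-hand side as coefficient of
    t^(n-1), since C(rk,k) is the coefficient of t^k in (1 + t)^(rk).  Dividing
    [kernel_poly * Q] by [kernel_poly] modulo t^n with [kernel_inverse] reads
    that coefficient off the numerator, whose t^n part does not contribute. *)
Lemma sum_bin_kernel n : (0 < n)%N ->
  \sum_(0 <= k < n) 'C(r * k, k)%:R * y ^+ k
  = - y ^+ n * \sum_(j < n) 'C(r * n, j)%:R * inv_coef (n.-1 - j).
Proof.
move=> n_gt0; have [E HE] := kernel_inverse n.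
pose Q : {poly L} := \sum_(k < n) 'X^(n.-1 - k) * (y *: (1 + 'X) ^+ r) ^+ k.
have HQ : kernel_poly * Q = 'X^n - (y *: (1 + 'X) ^+ r) ^+ n.
  by rewrite subrXX.
have := congr1 (fun q => (q * \poly_(k < n) inv_coef k)`_n.-1) HQ.
rewrite mulrAC HE mulrDl mul1r -mulrA mulrBl !coefD coefN !coefXnM.
rewrite prednK // leqnn addr0 sub0r => HS.
have -> : \sum_(0 <= k < n) 'C(r * k, k)%:R * y ^+ k = Q`_n.-1.
  rewrite big_mkord coef_sum; apply: eq_bigr => k _.
  rewrite coefXnM ltnNge leq_subr /=.
  have lekn : (k <= n.-1)%N by have := ltn_ord k; lia.
  by rewrite subKn // exprZn coefZ -exprM coef_1DX_exp mulrC.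
rewrite HS mulNr exprZn -scalerAl coefZ -exprM coefM.
case: n n_gt0 {Q HQ HS E HE} => // n _; congr (- (_ * _)); apply: eq_bigr => j _.
by rewrite coef_1DX_exp coef_poly ltnS leq_subr.
Qed.

(** Comparing coefficients of t^n in [kernel_poly * sum_n a_n t^n = 1] gives
    y a_n = a_(n-1) - y sum_(j < n) C(r,j+1) a_(n-1-j) for n > 0: one division
    by [y] per step. *)
Lemma inv_coef_int n : exists q : {poly int},
  (map_poly intr q).[y] = y ^+ n.+1 * inv_coef n.
Proof.
elim/ltn_ind: n => n IHn; have [E HE] := kernel_inverse n.+1.
have {HE} := congr1 (coefp n) HE; rewrite /= /kernel_poly mulrBl !coefB coefD.
rewrite coefXM [('X^_ * _)`_n]coefXnM ltnSn addr0 -scalerAl coefZ coefM.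
rewrite big_ord_recl coef_1DX_exp bin0 mul1r subn0 !coef_poly ltnSn.
have ex (j : 'I_n) : exists q : {poly int},
    (map_poly intr q).[y] = y ^+ (n - j) * inv_coef (n - j.+1).
  have lt_jn : (n - j.+1 < n)%N by have := ltn_ord j; lia.
  by have [q Hq] := IHn _ lt_jn; exists q; rewrite Hq subnSK.
case/fin_all_exists: ex => q Hq.
have -> : \sum_(i < n) ((1 + 'X : {poly L}) ^+ r)`_(lift ord0 i) *
      (\poly_(k < n.+1) inv_coef k)`_(n - lift ord0 i) =
    \sum_(i < n) 'C(r, i.+1)%:R * inv_coef (n - i.+1).
  apply: eq_bigr => i _; rewrite coef_1DX_exp coef_poly /= /bump add1n.
  by rewrite ltnS leq_subr.
case: n IHn q Hq {E} => [|n] IHn q Hq /=.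
  rewrite big_ord0 addr0 sub0r coef1 => H; exists (-1).
  by rewrite rmorphN1 !hornerE expr1 -[y * _]opprK H.
rewrite leqW // coef1 /= mulrDr opprD addrA addrAC => /eqP.
rewrite subr_eq0 => /eqP H.
exists (q ord0 - \sum_(i < n.+1) 'C(r, i.+1)%:R * 'X^(i.+1) * q i).
rewrite rmorphB /= hornerD hornerN rmorph_sum horner_sum /= Hq subn0 subn1 /=.
rewrite [y ^+ n.+2]exprSr -mulrA -H mulrBr; congr (_ - _).
rewrite mulrA mulr_sumr; apply: eq_bigr => i _.
rewrite !rmorphM /= rmorph_nat map_polyXn !hornerM hornerXn Hq.
rewrite -polyC_natr hornerC -mulrA [RHS]mulrCA; congr (_ * _).
rewrite mulrA -exprD -exprSr; congr (y ^+ _ * _).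
by have := ltn_ord i; lia.
Qed.

(** [sum_bin_kernel] with C(rp,j) replaced by r C(p,j) for 0 < j < p.  The error is
    an element of p^2 Z[y] because y^p a_(p-1-j) = y^j (y^(p-j) a_(p-1-j)). *)
Lemma sum_bin_congr p : prime p -> (2 < p)%N -> exists d : {poly int},
  \sum_(0 <= k < p) 'C(r * k, k)%:R * y ^+ k
  = - y ^+ p * \sum_i weight i
      * (r%:R - (r%:R - 1) * c i ^+ p - r%:R * (1 - c i) ^+ p)
    + p%:R ^+ 2 * (map_poly intr d).[y].
Proof.
move=> p_pr p_gt2; have p_gt0 := prime_gt0 p_pr.
have ex_e (j : 'I_p) : exists e : nat,
    (0 < j)%N -> 'C(r * p, j) = (r * 'C(p, j) + p ^ 2 * e)%N.
  case: (posnP j) => [->|j_gt0]; first by exists 0%N.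
  have [|e He] := @bin_mul_prime p r j p_pr; first by rewrite j_gt0 ltn_ord.
  by exists e.
case/fin_all_exists: ex_e => e He.
have ex_q (j : 'I_p) : exists q : {poly int},
    (map_poly intr q).[y] = y ^+ (p - j) * inv_coef (p.-1 - j).
  have [q Hq] := inv_coef_int (p.-1 - j); exists q; rewrite Hq.
  by congr (y ^+ _ * _); have := ltn_ord j; lia.
case/fin_all_exists: ex_q => q Hq.
exists (- \sum_(j < p | (0 < j)%N) (e j)%:R * 'X^j * q j).
rewrite sum_bin_kernel //.
have -> : (map_poly intr (- \sum_(j < p | (0 < j)%N) (e j)%:R * 'X^j * q j)).[y] =
   - y ^+ p * \sum_(j < p | (0 < j)%N) (e j)%:R * inv_coef (p.-1 - j).
  rewrite rmorphN rmorph_sum hornerN horner_sum /= mulNr mulr_sumr; congr (- _).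
  apply: eq_bigr => j _.
  rewrite !rmorphM /= rmorph_nat map_polyXn !hornerM hornerXn Hq.
  rewrite -polyC_natr hornerC -mulrA [RHS]mulrCA; congr (_ * _).
  by rewrite mulrA -exprD subnKC // ltnW.
rewrite [p%:R ^+ 2 * _]mulrCA -mulrDr; congr (_ * _).
pose o : 'I_p := Ordinal p_gt0.
have split_sum (F : 'I_p -> L) : \sum_j F j = F o + \sum_(j < p | (0 < j)%N) F j.
  rewrite (bigD1 o) //=; congr (_ + _); apply: eq_bigl => j.
  by rewrite -val_eqE /= lt0n.
have inv_coefE (j : 'I_p) :
    inv_coef (p.-1 - j) = - \sum_i weight i * (- c i) ^+ (p - j).
  rewrite -sumrN; apply: eq_bigr => i _.
  have -> : (p - j = (p.-1 - j).+1)%N by have := ltn_ord j; lia.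
  by rewrite exprS mulNr mulrN opprK mulrA.
have -> : \sum_(j < p) 'C(r * p, j)%:R * inv_coef (p.-1 - j) =
   inv_coef p.-1
   + r%:R * \sum_(j < p | (0 < j)%N) 'C(p, j)%:R * inv_coef (p.-1 - j)
   + p%:R ^+ 2 * \sum_(j < p | (0 < j)%N) (e j)%:R * inv_coef (p.-1 - j).
  rewrite split_sum /= bin0 mul1r subn0 -addrA; congr (_ + _).
  rewrite !mulr_sumr -big_split /=; apply: eq_bigr => j j_gt0.
  by rewrite He // natrD natrM [(p ^ 2 * _)%:R]natrM natrX mulrDl !mulrA.
congr (_ + _).
(* Oddness turns the term (- c_i)^p of (1 - c_i)^p into - c_i^p. *)
have odd_p : odd p by case: (even_prime p_pr) p_gt2 => // ->.
have binom i : \sum_(j < p | (0 < j)%N) 'C(p, j)%:R * (- c i) ^+ (p - j) =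
    (1 - c i) ^+ p + c i ^+ p - 1.
  rewrite [1 - _]addrC exprDn big_ord_recr /= subnn expr0 mul1r expr1n binn.
  rewrite mulr1n [_ + 1 + _]addrAC addrK split_sum /= subn0 expr0 mulr1 bin0 mulr1n.
  rewrite exprNn -signr_odd odd_p expr1 mulN1r addrAC addNr add0r.
  by apply: eq_bigr => j _; rewrite expr1n mulr1 mulr_natl.
have -> : \sum_(j < p | (0 < j)%N) 'C(p, j)%:R * inv_coef (p.-1 - j) =
    - \sum_i weight i * ((1 - c i) ^+ p + c i ^+ p - 1).
  under eq_bigr do rewrite inv_coefE mulrN mulr_sumr.
  rewrite sumrN exchange_big /=; congr (- _); apply: eq_bigr => i _.
  by rewrite -binom mulr_sumr; apply: eq_bigr => j _; rewrite mulrCA.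
have := inv_coefE o; rewrite /= !subn0 => ->.
rewrite mulrN mulr_sumr -opprD -big_split /= -sumrN; apply: eq_bigr => i _.
by rewrite exprNn -signr_odd odd_p expr1; ring.
Qed.
End PartialFractions.

(** * The congruence over a transcendental parameter *)

Section Transcendental.
Variables (L : fieldType) (r : nat) (y : L) (c : 'I_r -> L).
Hypothesis r_gt0 : (0 < r)%N.
Hypothesis y_trans :
  forall q : {poly int}, (map_poly intr q).[y] = 0 -> q = 0.
Hypothesis hc : y *: ('X - 1) ^+ r + 'X^(r.-1)
          = y *: \prod_(i < r) ('X - (c i)%:P).

(** A root c_i = z would make [y] a root of (z - 1)^r X + z^(r-1).  The values
    z = 0 and z = 1 - r are those where the partial fractions break down. *)
Lemma root_neq_int (z : int) i : z != 1 -> c i != z%:~R.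
Proof.
move=> z_neq1; apply/eqP => cz.
have /(congr1 (coefp 1))/eqP :
    ((z - 1) ^+ r) *: 'X + (z ^+ r.-1)%:P = 0 :> {poly int}.
  apply: y_trans; rewrite rmorphD /= map_polyZ map_polyX map_polyC /= !hornerE.
  have := congr1 (horner^~ (c i)) hc; rewrite [RHS]hornerZ horner_prod.
  rewrite (bigD1 i) //= !hornerXsubC subrr mul0r mulr0 => <-.
  by rewrite !hornerE cz rmorphXn rmorphB /= rmorphXn mulrC.
rewrite /= coefD coefZ coefX coefC addr0 mulr1 coef0 expf_eq0 r_gt0 /=.
by rewrite subr_eq0 (negPf z_neq1).
Qed.

Lemma sum_bin_congr_transcendental p :
  prime p -> (2 < p)%N -> exists d : {poly int},
  \sum_(0 <= k < p) 'C(r * k, k)%:R * y ^+ k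
  = - y ^+ p * \sum_i (c i - 1) / (r%:R - 1 + c i)
      * (r%:R - (r%:R - 1) * c i ^+ p - r%:R * (1 - c i) ^+ p)
    + p%:R ^+ 2 * (map_poly intr d).[y].
Proof.
apply: sum_bin_congr => //.
- move=> n n0; have /(congr1 (coefp 0))/eqP : n%:R = 0 :> {poly int}.
    by apply: y_trans; rewrite rmorph_nat -polyC_natr hornerC.
  by rewrite /= -polyC_natr coefC coef0 /= pnatr_eq0 => /eqP.
- by move=> i; have := @root_neq_int 0 i isT; rewrite rmorph0.
- move=> i; have := @root_neq_int (1 - r%:R) i.
  rewrite rmorphB /= rmorph1 rmorph_nat => H; apply: contra_neq (H _).
    by move=> E; apply/eqP; rewrite -subr_eq0 -E; apply/eqP; ring.
  by rewrite -subr_eq0 addrC addrA addNr add0r oppr_eq0 pnatr_eq0 -lt0n.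
Qed.
End Transcendental.

(** * The p-adic valuation *)

Lemma fraction_numdenE (R : idomainType) (z : {fraction R}) :
  z * (\d_(repr z))%:F = (\n_(repr z))%:F.
Proof.
rewrite -{1}[z]reprK; unlock FracField.tofrac; rewrite -[LHS]FracField.pi_mul.
apply/eqmodP; rewrite /= FracField.equivfE /FracField.mulf.
rewrite !numden_Ratio ?oner_eq0 ?mulf_neq0 ?oner_eq0 ?denom_ratioP //.
by rewrite !mulr1 mulrC.
Qed.

Section PadicValuation.
Variables (p : nat) (p_pr : prime p).
Local Notation Zp := (padic_int p_pr).
Local Notation v := (@padic_int_val p p_pr).
Implicit Types x y : Zp.

(** Reads every low component on one high component, so that valuations of
    products become p-parts of natural numbers. *)
Lemma padic_comp_eq0 x m n : (m <= n)%N -> (x m == 0) = (p ^ m.+1 %| x n)%N.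
Proof.
move=> /subnK <-; rewrite /dvdn -padic_modn.
by apply/eqP/eqP => [->//|xm0]; apply: val_inj.
Qed.

Lemma padic_mul_comp_eq0 x y m n : (m <= n)%N ->
  ((x * y) m == 0) = (p ^ m.+1 %| x n * y n)%N.
Proof.
move=> mn; rewrite (padic_comp_eq0 _ mn).
have -> : ((x * y)%R n : nat) = ((x n * y n) %% p ^ n.+1)%N.
  have -> : (x * y)%R n = (x n * y n)%N%:R by rewrite natrM !natr_Zp.
  exact: val_ZpowE.
by rewrite /dvdn modn_dvdm // dvdn_exp2l.
Qed.

Lemma padic_int_val_eq x n : x n != 0 -> (forall m, (m < n)%N -> x m = 0) ->
  v x = n%:Z%:E.
Proof.
move=> xn0 xlt; rewrite /padic_int_val; case: pselect => [ex|[]]; last by exists n.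
case: ex_minnP => k xk0 kmin; congr (Posz _)%:E; apply/eqP.
rewrite eqn_leq kmin // leqNgt; apply: contra xk0 => /xlt ->; exact: eqxx.
Qed.

Lemma padic_int_val0 : v 0 = +oo%E.
Proof.
rewrite /padic_int_val; case: pselect => // ex.
by case: (ex_minnP ex) => n; rewrite eqxx.
Qed.

Variant padic_int_val_spec x : \bar int -> Prop :=
| PadicValZero of x = 0 : padic_int_val_spec x +oo%E
| PadicValFin n of x != 0 & x n != 0 & (forall m, (m < n)%N -> x m = 0) :
    padic_int_val_spec x n%:Z%:E.

Lemma padic_int_valP x : padic_int_val_spec x (v x).
Proof.
have [->|x0] := eqVneq x 0; first by rewrite padic_int_val0; constructor.
have [n xn0 nmin] : exists2 n, x n != 0 & forall m, (m < n)%N -> x m = 0.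
  have ex : exists n, x n != 0.
    apply: contrapT => nex; case/eqP: x0; apply: padic_ext => n.
    by apply/eqP; apply: contrapT => xn; apply: nex; exists n; apply/negP.
  case: (ex_minnP ex) => n xn0 nmin; exists n => // m; rewrite ltnNge => mn.
  by apply/eqP; apply: contraNT mn; apply: nmin.
by rewrite (padic_int_val_eq xn0 nmin); constructor.
Qed.

(** If [x] and [y] have valuations [a] and [b], these are the p-adic valuations
    of the natural numbers [x (a + b)] and [y (a + b)], and the component
    [a + b] is the first one where the product can be nonzero. *)
Lemma padic_int_valM x y : v (x * y) = (v x + v y)%E.
Proof.
case: (padic_int_valP x) => [->|a _ xa xlt].
  by rewrite mul0r padic_int_val0 addye //; case: (padic_int_valP y).
case: (padic_int_valP y) => [->|b _ yb ylt]; first by rewrite mulr0 padic_int_val0.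
have lognE (z : Zp) k n :
    (k <= n)%N -> z k != 0 -> (forall m, (m < k)%N -> z m = 0) ->
    (0 < z n)%N /\ logn p (z n) = k.
  move=> kn; rewrite (padic_comp_eq0 _ kn) => nd zlt.
  have z_gt0 : (0 < z n)%N by case: posnP nd => // ->; rewrite dvdn0.
  split=> //; apply/eqP; rewrite eqn_leq; move: nd.
  rewrite pfactor_dvdn // -ltnNge ltnS => -> /=.
  case: k kn zlt => // k kn zlt; rewrite -pfactor_dvdn //.
  by rewrite -(padic_comp_eq0 z (ltnW kn)) zlt.
have [xg lx] := lognE x a (a + b)%N (leq_addr _ _) xa xlt.
have [yg ly] := lognE y b (a + b)%N (leq_addl _ _) yb ylt.
have lxy k : (p ^ k %| x (a + b)%N * y (a + b)%N)%N = (k <= a + b)%N.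
  by rewrite pfactor_dvdn ?muln_gt0 ?xg // lognM // lx ly.
rewrite (@padic_int_val_eq _ (a + b)%N) //.
  by rewrite (padic_mul_comp_eq0 _ _ (leqnn _)) lxy ltnn.
by move=> m mlt; apply/eqP; rewrite (padic_mul_comp_eq0 _ _ (ltnW mlt)) lxy.
Qed.

Lemma padic_int_val_ge x n :
  (n%:Z%:E <= v x)%E <-> forall m, (m < n)%N -> x m = 0.
Proof.
case: (padic_int_valP x) => [->|a _ xa xlt]; first by rewrite leey.
rewrite lee_fin lez_nat; split=> [le_na m mn|xn]; first exact/xlt/(leq_trans mn).
by rewrite leqNgt; apply: contra xa => /xn ->; exact: eqxx.
Qed.

Lemma padic_int_val_ge0 x : (0 <= v x)%E.
Proof. by apply/(padic_int_val_ge x 0). Qed.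

Lemma padic_int_val_fin x : x != 0 -> v x \is a fin_num.
Proof. by case: (padic_int_valP x) => [->|//]; rewrite eqxx. Qed.

Lemma padic_int_valD x y : (Order.min (v x) (v y) <= v (x + y)%R)%E.
Proof.
wlog le_xy : x y / (v x <= v y)%E.
  by move=> H; case/orP: (le_total (v x) (v y)) => [/H//|/H]; rewrite addrC minC.
rewrite min_l //; case: (padic_int_valP x) le_xy => [-> | a _ _ xlt le_xy].
  by rewrite leye_eq add0r => /eqP ->; rewrite leey.
apply/(padic_int_val_ge _ a) => m mn.
by rewrite /= xlt // (proj1 (padic_int_val_ge y a) le_xy) // addr0.
Qed.

(** The valuation of a fraction may be computed on any representative, by
    multiplicativity; this frees the sequel from the one chosen by [repr]. *)
Lemma padic_val_frac (n d : Zp) : d != 0 ->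
  padic_val (n%:F / d%:F : padic p_pr) = (v n - v d)%E.
Proof.
move=> d0; rewrite /padic_val; set z := _ / _.
have e0 := denom_ratioP (repr z).
set n' := \n_(repr z); set d' := \d_(repr z).
have nd : n' * d = n * d'.
  apply/eqP; rewrite -tofrac_eq !tofracM -fraction_numdenE /z mulrAC divfK //.
  by rewrite tofrac_eq0.
have : (v n' + v d = v n + v d')%E by rewrite -!padic_int_valM nd.
move: (padic_int_val_fin d0) (padic_int_val_fin e0); rewrite -/d'.
case: (padic_int_valP n') => [n'0|a _ _ _]; case: (padic_int_valP n) => [n0|b _ _ _];
  case: (padic_int_valP d) => [_|c _ _ _];
  case: (padic_int_valP d') => [_|e _ _ _] //= _ _.
by rewrite -!EFinD => -[H]; congr _%:E; lia.
Qed.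

Lemma padic_fracW (z : padic p_pr) : exists n d : Zp, d != 0 /\ z = n%:F / d%:F.
Proof.
exists \n_(repr z), \d_(repr z); have d0 := denom_ratioP (repr z).
by split=> //; rewrite -fraction_numdenE mulfK // tofrac_eq0.
Qed.

Lemma padic_val_fin (z : padic p_pr) : z != 0 -> padic_val z \is a fin_num.
Proof.
have [n [d [d0 ->]]] := padic_fracW z; rewrite padic_val_frac // => z0.
rewrite fin_numB !padic_int_val_fin //; apply: contraNneq z0 => ->.
by rewrite tofrac0 mul0r.
Qed.

Lemma padic_val0 : padic_val (0 : padic p_pr) = +oo%E.
Proof.
rewrite -[0](mul0r (1%:F)^-1) -tofrac0 padic_val_frac ?oner_eq0 // padic_int_val0.
by have := padic_int_val_fin (oner_neq0 Zp); case: (v 1).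
Qed.

Lemma padic_valD (k : \bar int) (z t : padic p_pr) :
  (k <= padic_val z -> k <= padic_val t -> k <= padic_val (z + t)%R)%E.
Proof.
have [n [d [d0 ->]]] := padic_fracW z; have [m [e [e0 ->]]] := padic_fracW t.
rewrite addf_div ?tofrac_eq0 // -!tofracM -tofracD.
rewrite !padic_val_frac ?mulf_neq0 //.
have fd := padic_int_val_fin d0; have fe := padic_int_val_fin e0.
rewrite !leeBrDr ?padic_int_valM ?fin_numD ?fd //.
move=> kn km; apply: le_trans (padic_int_valD _ _); rewrite !padic_int_valM le_min.
by rewrite addeA leeD2r //= addeAC leeD2r.
Qed.

Lemma padic_val_intM (k : \bar int) (a : int) (z : padic p_pr) :
  (k <= padic_val z -> k <= padic_val (a%:~R * z)%R)%E.
Proof.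
have [n [d [d0 ->]]] := padic_fracW z.
rewrite mulrA -(rmorph_int (@FracField.tofrac Zp)) -tofracM.
rewrite !padic_val_frac // => /le_trans; apply.
by rewrite padic_int_valM leeD2r // leeDr // padic_int_val_ge0.
Qed.

(** * The Gauss valuation and the embedding of Z[x] *)

Lemma gauss_poly_val_coef (b : {poly padic p_pr}) k :
  (gauss_poly_val b <= padic_val b`_k)%E.
Proof.
rewrite /gauss_poly_val; case: (ltnP k (size b)) => [lt_k|le_k]; last first.
  by rewrite nth_default // padic_val0 leey.
exact: (bigmin_le_cond _ (j := Ordinal lt_k)).
Qed.

Lemma gauss_poly_val_fin (b : {poly padic p_pr}) : b != 0 ->
  gauss_poly_val b \is a fin_num.
Proof.
move=> b0; rewrite fin_numE; apply/andP; split.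
  rewrite -ltNye; apply/bigmin_gtP; split=> [|i _]; first by rewrite ltNye.
  have [->|/padic_val_fin] := eqVneq b`_i 0; first by rewrite padic_val0 ltNye.
  by rewrite fin_numE ltNye => /andP[].
rewrite -ltey; apply: le_lt_trans (gauss_poly_val_coef b (size b).-1) _.
have /padic_val_fin : b`_(size b).-1 != 0 by rewrite -lead_coefE lead_coef_eq0.
by rewrite fin_numE ltey => /andP[].
Qed.

(** The representative [repr] of D / 1 has numerator D b and denominator b for
    some b.  The coefficients of D b are Z-linear combinations of those of b,
    so their valuations are at least that of b. *)
Lemma gauss_ring_int (d : {poly int}) :
  (map_poly intr d)%:F \in @gauss_ring p p_pr.
Proof.
set D : {poly padic p_pr} := map_poly intr d; set z : padic_ratfun p_pr := D%:F.
rewrite unfold_in /gauss_ring /gauss_val.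
set b := \d_(repr z); have b0 : b != 0 := denom_ratioP (repr z).
have -> : \n_(repr z) = D * b.
  by apply/eqP; rewrite -tofrac_eq -fraction_numdenE tofracM.
rewrite sube_ge0; last by rewrite (gauss_poly_val_fin b0) ?orbT.
apply/bigmin_geP; split=> [|i _]; first by rewrite leey.
rewrite coefM; elim/big_ind: _ => [|z1 z2|j _].
- by rewrite padic_val0 leey.
- exact: padic_valD.
- by rewrite coef_map; apply/padic_val_intM/gauss_poly_val_coef.
Qed.

Lemma padic_pchar0 : [pchar padic p_pr] =i pred0.
Proof.
apply/pcharf0P => n; rewrite -(rmorph_nat (@FracField.tofrac Zp)) tofrac_eq0.
have natE k : (n%:R : Zp) k = n%:R.
  by elim: n => // n IHn; rewrite !mulrS -IHn.
apply/eqP/eqP => [n0|->//].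
(* The component of index n is taken modulo p^(n+1), which exceeds n. *)
have := natE n; rewrite n0 => /(congr1 (@nat_of_ord _)) /=.
rewrite (val_ZpowE p_pr n n) modn_small => [<-//|].
by rewrite (ltn_trans (ltn_expl n (prime_gt1 p_pr))) // ltn_exp2l ?prime_gt1.
Qed.

Section Extension.
Variable L : fieldExtType (padic_ratfun p_pr).
Local Notation x := (ratfunX p_pr).

Lemma horner_int_alg (q : {poly int}) :
  (map_poly intr q).[x%:A] = ((map_poly intr q)%:F : padic_ratfun p_pr)%:A :> L.
Proof.
elim/poly_ind: q => [|q a IHq].
  by rewrite !rmorph0 horner0 scale0r.
rewrite !rmorphD !rmorphM /= !map_polyX !map_polyC /= !hornerE IHq.
rewrite scalerDl; congr (_ + _).
  by rewrite -scalerAl mul1r scalerA.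
by rewrite (rmorph_int (@polyC _)) (rmorph_int (@FracField.tofrac _)) scaler_int.
Qed.

Lemma horner_int_eq0 (q : {poly int}) :
  (map_poly intr q).[x%:A : L] = 0 -> q = 0.
Proof.
rewrite horner_int_alg => /eqP; rewrite scaler_eq0 oner_eq0 orbF tofrac_eq0.
move=> /eqP/polyP q0; apply/polyP => i; have := q0 i.
rewrite coef_map !coef0 /= => /eqP; have /pcharf0P char0 := padic_pchar0.
by case: (q`_i) => n; rewrite ?NegzE ?mulrNz ?oppr_eq0 -pmulrn char0 => /eqP ->.
Qed.
End Extension.
End PadicValuation.

Theorem theorem15 (p : nat) (p_pr : prime p) (p_gt2 : (2 < p)%N)
    (r : nat) (r_ge1 : (1 <= r)%N)
    (L : fieldExtType (padic_ratfun p_pr)) (c : 'I_r -> L)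
    (x := ratfunX p_pr)
    (hc : x%:A *: ('X - 1) ^+ r + 'X^(r.-1)
          = x%:A *: \prod_(i < r) ('X - (c i)%:P) :> {poly L}) :
  exists2 B : padic_ratfun p_pr,
    B%:A = - x%:A ^+ p *
      \sum_(i < r) (c i - 1) / (r%:R - 1 + c i)
        * (r%:R - (r%:R - 1) * c i ^+ p - r%:R * (1 - c i) ^+ p)
    & gauss_congr 2 (\sum_(0 <= k < p) 'C(r * k, k)%:R * x ^+ k) B.
Proof.
have [d Hd] := sum_bin_congr_transcendental r_ge1 (@horner_int_eq0 p p_pr L) hc
  p_pr p_gt2.
exists (\sum_(0 <= k < p) 'C(r * k, k)%:R * x ^+ k
        - p%:R ^+ 2 * (map_poly intr d)%:F).
  rewrite -[LHS]/(in_alg L _) rmorphB rmorph_sum rmorphM rmorphXn rmorph_nat /=.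
  rewrite -horner_int_alg; apply/eqP; rewrite subr_eq -Hd; apply/eqP.
  apply: eq_bigr => k _.
  by rewrite -[LHS]/(in_alg L _) rmorphM rmorph_nat rmorphXn.
exists (map_poly intr d)%:F; first exact: gauss_ring_int.
by rewrite opprB addrC subrK.
Qed.
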